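(* For every integer $n\geq 1$, let $C_{\mathrm{NFW}}(n)$ be the maximum of $C_{\mathrm{NFW}}(\mathcal{A})$ over all NFWs $\mathcal{A}$ with $n$ states. Then $C_{\mathrm{NFW}}(n)=C_{\mathrm{NFW}}(\mathcal{A})$ for some full NFW $\mathcal{A}$ with $n$ states.
   Context: An NFW (nondeterministic finite word automaton) is $\mathcal{A}=(\Sigma,S,I,\Delta,F)$ with finite alphabet $\Sigma$, finite state set $S$, initial states $I\subseteq S$, transition relation $\Delta\subseteq S\times\Sigma\times S$ and final states $F\subseteq S$. A finite word $a(0)\cdots a(l-1)$ is accepted if there is a state sequence $\rho(0)\cdots\rho(l)$ with $\rho(0)\in I$, $\rho(l)\in F$ and $\langle\rho(i),a(i),\rho(i+1)\rangle\in\Delta$ for all $i<l$. $\mathcal{L}(\mathcal{A})$ is the set of accepted words. $C_{\mathrm{NFW}}(\mathcal{A})$ is the minimum number of states of an NFW (over the same alphabet) accepting $\Sigma^*\setminus\mathcal{L}(\mathcal{A})$. A full NFW is one of the form $(\Sigma,S,I,\Delta,F)$ where $S$ is a finite set, $I,F\subseteq S$ are arbitrary, $\Sigma=\mathcal{P}(S\times S)$ is the set of all binary relations on $S$, and $\langle p,a,q\rangle\in\Delta$ iff $\langle p,q\rangle\in a$. *)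

(* Defs.v *)
From mathcomp Require Import all_boot.
From mathcomp Require Import boolp classical_sets.
Set Implicit Arguments.
Unset Strict Implicit.
Unset Printing Implicit Defensive.

Local Open Scope classical_set_scope.

Record nfw (Sigma : finType) := NFW {
  state :> finType;
  init : {set state};
  trans : {set state * Sigma * state};
  final : {set state} }.

(* Only the values rho 0, ..., rho (size w) matter. *)
Definition accepts (Sigma : finType) (A : nfw Sigma) (w : seq Sigma) : Prop :=
  exists rho : nat -> A,
    [/\ rho 0 \in init A,
        rho (size w) \in final A
      & forall i : 'I_(size w),
          (rho i, tnth (in_tuple w) i, rho i.+1) \in trans A].

Definition language (Sigma : finType) (A : nfw Sigma) : set (seq Sigma) :=
  [set w | accepts A w].

Definition compl_size (Sigma : finType) (A : nfw Sigma) (k : nat) : Prop :=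
  exists B : nfw Sigma, #|B| = k /\ language B = ~` language A.

(* The subset construction shows that the minimum and the maximum below exist. *)
Section SubsetConstruction.
Variables (Sigma : finType) (A : nfw Sigma).

Definition post (P : {set A}) (a : Sigma) : {set A} :=
  [set q | [exists p in P, (p, a, q) \in trans A]].

Definition subset_compl : nfw Sigma :=
  @NFW Sigma {set A} [set init A]
    [set t | t.2 == post t.1.1 t.1.2]
    [set P : {set A} | P :&: final A == finset.set0].

Lemma accepts_foldl (w : seq Sigma) :
  accepts A w <-> foldl post (init A) w :&: final A != finset.set0.
Proof.
suff gen (P : {set A}) :
    (exists rho : nat -> A, [/\ rho 0 \in P, rho (size w) \in final A
      & forall i : 'I_(size w),
          (rho i, tnth (in_tuple w) i, rho i.+1) \in trans A]) <->
    foldl post P w :&: final A != finset.set0 by exact: gen.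
elim: w P => [|a w IHw] P /=.
  split=> [[rho [P0 F0 _]]|/set0Pn[p /setIP[pP pF]]].
    by apply/set0Pn; exists (rho 0); apply/setIP.
  by exists (fun _ => p); split=> // -[].
rewrite -IHw; split=> [[rho [P0 Fl step]]|[rho [P0 Fl step]]].
  exists (fun i => rho i.+1); split=> // [|i].
    by rewrite inE; apply/existsP; exists (rho 0); rewrite P0; have := step ord0.
  by have := step (lift ord0 i); rewrite !(tnth_nth a).
move: P0; rewrite inE => /existsP[p /andP[pP pt]].
exists (fun i => if i is j.+1 then rho j else p); split=> // -[[|i] lti].
  by rewrite (tnth_nth a).
by have := step (Ordinal (lti : i < size w)); rewrite !(tnth_nth a).
Qed.

Lemma accepts_subset_compl (w : seq Sigma) :
  accepts subset_compl w <-> foldl post (init A) w :&: final A == finset.set0.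
Proof.
suff gen (P : {set A}) :
    (exists rho : nat -> subset_compl,
      [/\ rho 0 \in [set P]%SET, rho (size w) \in final subset_compl
      & forall i : 'I_(size w),
          (rho i, tnth (in_tuple w) i, rho i.+1) \in trans subset_compl]) <->
    foldl post P w :&: final A == finset.set0 by exact: gen.
elim: w P => [|a w IHw] P /=.
  split=> [[rho [/set1P P0]]|PF]; first by rewrite inE P0.
  by exists (fun _ => P); split; rewrite ?inE // => -[].
rewrite -IHw; split=> [[rho [/set1P P0 Fl step]]|[rho [/set1P P0 Fl step]]].
  exists (fun i => rho i.+1); split=> // [|i].
    by have := step ord0; rewrite !inE P0.
  by have := step (lift ord0 i); rewrite !(tnth_nth a).
exists (fun i => if i is j.+1 then rho j else P).
split=> // [|[[|i] lti]]; first by rewrite inE.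
  by rewrite (tnth_nth a) !inE /= P0.
by have := step (Ordinal (lti : i < size w)); rewrite !(tnth_nth a).
Qed.

Lemma compl_size_subset : compl_size A (2 ^ #|A|).
Proof.
exists subset_compl; split; first by rewrite /= -cardsT -powersetT card_powerset cardsT.
apply/seteqP; split=> w /=; rewrite /language /= accepts_subset_compl.
  by move=> /eqP e /accepts_foldl; rewrite e eqxx.
by move=> nA; apply: contra_notT nA => ?; apply/accepts_foldl.
Qed.

Lemma compl_size_ex : exists k, `[< compl_size A k >].
Proof. by exists (2 ^ #|A|); apply/asboolP/compl_size_subset. Qed.

End SubsetConstruction.

Definition C_NFW (Sigma : finType) (A : nfw Sigma) : nat :=
  ex_minn (compl_size_ex A).

(* [c] is the value of [C_NFW] at an NFW with [n] states, over any alphabet. *)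
Definition attained (n c : nat) : Prop :=
  exists (Sigma : finType) (A : nfw Sigma), #|A| = n /\ C_NFW A = c.

Lemma attained_ex n : exists c, `[< attained n c >].
Proof.
pose A := @NFW bool 'I_n finset.set0 finset.set0 finset.set0.
exists (C_NFW A); apply/asboolP; exists bool, A; split=> //; exact: card_ord.
Qed.

Lemma attained_le n c : `[< attained n c >] -> c <= 2 ^ n.
Proof.
move=> /asboolP[Sigma [A [<- <-]]]; rewrite /C_NFW; case: ex_minnP => k _.
by apply; apply/asboolP/compl_size_subset.
Qed.

Definition C_NFW_max (n : nat) : nat :=
  ex_maxn (attained_ex n) (@attained_le n).

Definition full_nfw (S : finType) (I F : {set S}) : nfw {set S * S} :=
  @NFW {set S * S} S I [set t : S * {set S * S} * S | (t.1.1, t.2) \in t.1.2] F.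

(* Main.v *)
Require Import Defs.
From mathcomp Require Import all_boot.
From mathcomp Require Import boolp classical_sets.

(** Reading each letter [a] of an NFW [A] as its transition relation
    [{(p, q) | (p, a, q) \in trans A}] makes [L(A)] the preimage, under a
    letter-to-letter map, of the language of the full NFW with the states,
    initial states and final states of [A]. Preimages under letter maps commute
    with complement and do not increase the number of states, so an NFW
    complementing the full NFW yields one of the same size complementing [A]. *)

Definition preim_nfw {Sigma Gamma : finType} (h : Sigma -> Gamma)
    (B : nfw Gamma) : nfw Sigma :=
  @NFW Sigma B (init B)
    [set t : B * Sigma * B | (t.1.1, h t.1.2, t.2) \in trans B] (final B).

(** Both automata have the same states, so one [rho] is an accepting run for both. *)
Lemma accepts_preim_nfw {Sigma Gamma : finType} (h : Sigma -> Gamma)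
    (B : nfw Gamma) (w : seq Sigma) :
  accepts (preim_nfw h B) w <-> accepts B (map h w).
Proof.
split=> -[rho [I0 Fl step]]; exists rho; split=> //.
- by rewrite size_map.
- case=> i lti; have lti' : i < size w by rewrite size_map in lti.
  have := step (Ordinal lti'); rewrite inE /= => st.
  (* A position [i] exists, so [w] is nonempty; its head [a] serves as the default letter for
     [nth]. *)
  case: w {I0 Fl step} lti lti' st => [|a w] lti lti' st; first by [].
  by move: st; rewrite !(tnth_nth a, tnth_nth (h a)) /= -(nth_map a (h a)).
- by move: Fl; rewrite size_map.
- case=> i lti; have lti' : i < size (map h w) by rewrite size_map.
  have := step (Ordinal lti'); rewrite inE /= => st.
  case: w {I0 Fl step} lti lti' st => [|a w] lti lti' st; first by [].
  by move: st; rewrite !(tnth_nth a, tnth_nth (h a)) /= -(nth_map a (h a)).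
Qed.

Lemma C_NFW_preim {Sigma Gamma : finType} (h : Sigma -> Gamma) (B : nfw Gamma) :
  C_NFW (preim_nfw h B) <= C_NFW B.
Proof.
rewrite {2}/C_NFW; case: ex_minnP => _ /asboolP[D [<- LD]] _.
rewrite /C_NFW; case: ex_minnP => m _; apply; apply/asboolP.
exists (preim_nfw h D); split=> //; apply/seteqP.
have LDw w : accepts D (map h w) <-> ~ accepts B (map h w).
  by have := congr1 (@^~ (map h w)) LD; rewrite /language /= => ->.
by split=> w; rewrite /language /= !accepts_preim_nfw LDw.
Qed.

Definition letter_rel {Sigma : finType} (A : nfw Sigma) (a : Sigma) :
    {set A * A} :=
  [set pq : A * A | (pq.1, a, pq.2) \in trans A].

Lemma preim_full_nfw {Sigma : finType} (A : nfw Sigma) :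
  preim_nfw (letter_rel A) (full_nfw (init A) (final A)) = A.
Proof.
(* States, initial and final states agree by conversion; only the transition sets need comparing. *)
case: A => S I T F; congr NFW.
by apply/setP=> -[[p a] q]; rewrite !inE.
Qed.

Lemma C_NFW_le_full {Sigma : finType} (A : nfw Sigma) :
  C_NFW A <= C_NFW (full_nfw (init A) (final A)).
Proof. by rewrite -{1}(preim_full_nfw A) C_NFW_preim. Qed.

Theorem theorem3p3 (n : nat) (hn : 1 <= n) :
  exists (S : finType) (I F : {set S}),
    #|full_nfw I F| = n /\ C_NFW_max n = C_NFW (full_nfw I F).
Proof.
rewrite /C_NFW_max; case: ex_maxnP => _ /asboolP[Sigma [A [cA <-]]] maxA.
exists (state A), (init A), (final A); split=> //.
(* [A] attains the maximum, which the full NFW, also with [n] states, cannot exceed. *)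
apply/eqP; rewrite eqn_leq C_NFW_le_full; apply: maxA; apply/asboolP.
by exists {set A * A}, (full_nfw (init A) (final A)).
Qed.
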